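(* Let $1\le M\le N$ and let $\beta\ge\lambda_1\ge\lambda_2\ge\cdots\ge\lambda_M\ge\alpha$ be real random variables whose ordered joint p.d.f. on the region $\beta\ge x_1\ge\cdots\ge x_M\ge\alpha$ is $$f_{\boldsymbol\lambda}(\boldsymbol x)=K\,\det\boldsymbol\Phi(\boldsymbol x)\,\det\boldsymbol\Psi(\boldsymbol x)\prod_{i=1}^{M}\xi(x_i),$$ where $K$ is the normalizing constant, $\xi$ is a function, $\boldsymbol\Phi(\boldsymbol x)\in\mathbb C^{M\times M}$ has entries $\Phi_i(x_j)$, and $\boldsymbol\Psi(\boldsymbol x)\in\mathbb C^{N\times N}$ has entries $\Psi_i(x_j)$ for $j\le M$ and constants $\bar\Psi_{i,j}$ for $M<j\le N$. Let $\varphi_1,\dots,\varphi_M:\mathbb R\to\mathbb C$ be arbitrary functions. Then, denoting now by $\lambda_1,\dots,\lambda_M$ the unordered eigenvalues, $$\mathbb E\left\{\prod_{\ell=1}^M\varphi_\ell(\lambda_\ell)\right\}=\frac{K}{M!}\,\mathcal T(\boldsymbol A),$$ where the $N\times N\times N$ tensor $\boldsymbol A$ has elements $$a_{i,j,k}=\begin{cases}\displaystyle\int_\alpha^\beta\Phi_i(x)\Psi_j(x)\xi(x)\varphi_k(x)\,dx& i\le M,\ k\le M\\ \displaystyle\int_\alpha^\beta\Psi_j(x)\xi(x)\varphi_k(x)\,dx& i>M,\ k\le M\\ 0& i<k,\ k>M\\ \bar\Psi_{j,k}& i\ge k,\ k>M.\end{cases}$$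
   Context: The unordered eigenvalues are the random vector obtained by applying to the ordered vector $(\lambda_1,\dots,\lambda_M)$ an independent uniformly random permutation of its coordinates. For a rank-3 tensor $\boldsymbol A=\{a_{i,j,k}\}_{i,j,k=1,\dots,N}$ the pseudo-determinant is $\mathcal T(\boldsymbol A)=\sum_{\boldsymbol\mu}\operatorname{sgn}(\boldsymbol\mu)\sum_{\boldsymbol\alpha}\operatorname{sgn}(\boldsymbol\alpha)\prod_{k=1}^N a_{\mu_k,\alpha_k,k}$, where both sums run over all permutations of $\{1,\dots,N\}$. The endpoints $\alpha<\beta$ may be infinite. The scalar functions $\Phi_i$ ($1\le i\le M$), $\Psi_i$ ($1\le i\le N$), $\xi$, $\varphi_k$ and the constants $\bar\Psi_{i,j}$ are arbitrary, subject to the function $f_{\boldsymbol\lambda}(\boldsymbol x)=K\,\det\boldsymbol\Phi(\boldsymbol x)\,\det\boldsymbol\Psi(\boldsymbol x)\prod_{i=1}^{M}\xi(x_i)$ being a p.d.f. on the ordered region $\beta\ge x_1\ge\cdots\ge x_M\ge\alpha$ and to the integrals appearing being well defined (absolutely convergent). *)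

(* Defs.v *)
From HB Require Import structures.
From mathcomp Require Import all_boot all_order all_algebra all_fingroup.
From mathcomp Require Import all_classical all_reals all_analysis.
From mathcomp Require Import complex.

Set Implicit Arguments.
Unset Strict Implicit.
Unset Printing Implicit Defensive.

Import Order.TTheory GRing.Theory Num.Theory.
Import numFieldNormedType.Exports.

Local Open Scope classical_set_scope.
Local Open Scope ring_scope.
Local Open Scope complex_scope.

(** Lebesgue measure on [n.-tuple R], built by induction on [n] as the image of
    the product [lebesgue_measure \x leb_n] under [(x, t) |-> x :: t].  The
    bundled type carries the sigma-finiteness that products require. *)

Section tuple_cons_measure.
Context (R : realType) (n : nat).
Let T := measurableTypeR R.
Variable mu : {sigma_finite_measure set (n.-tuple T) -> \bar R}.

Definition pair_cons (p : T * n.-tuple T) : n.+1.-tuple T :=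
  [the n.+1.-tuple T of p.1 :: p.2].

Definition pair_uncons (t : n.+1.-tuple T) : T * n.-tuple T :=
  (thead t, [tuple of behead t]).

Lemma pair_consK : cancel pair_cons pair_uncons.
Proof. by move=> [x t]; congr pair; apply/val_inj. Qed.

Lemma measurable_pair_cons : measurable_fun setT pair_cons.
Proof. exact: (measurable_cons measurable_fst measurable_snd). Qed.

Lemma measurable_pair_uncons : measurable_fun setT pair_uncons.
Proof.
apply/measurable_fun_pairP; split.
- exact: measurable_tnth.
- exact: measurable_behead.
Qed.

Definition cons_measure : set (n.+1.-tuple T) -> \bar R :=
  pushforward (@lebesgue_measure R \x mu)%E pair_cons.

Let cons_measure0 : cons_measure set0 = 0%E.
Proof. by rewrite /cons_measure /pushforward preimage_set0 measure0. Qed.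

Let cons_measure_ge0 A : (0 <= cons_measure A)%E.
Proof. by rewrite /cons_measure /pushforward measure_ge0. Qed.

Let cons_measure_sigma_additive : semi_sigma_additive cons_measure.
Proof.
move=> F mF tF mUF; rewrite /cons_measure /pushforward preimage_bigcup.
apply: measure_semi_sigma_additive.
- by move=> k; rewrite -[X in measurable X]setTI; exact: measurable_pair_cons.
- apply/trivIsetP => /= i j _ _ ij; rewrite -preimage_setI.
  by move/trivIsetP : tF => /(_ _ _ _ _ ij) ->//; rewrite preimage_set0.
- rewrite -preimage_bigcup -[X in measurable X]setTI.
  exact: measurable_pair_cons.
Qed.

HB.instance Definition _ := isMeasure.Build _ _ _ cons_measure
  cons_measure0 cons_measure_ge0 cons_measure_sigma_additive.

Let cons_measure_sigma_finite : sigma_finite setT cons_measure.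
Proof.
have /sigma_finiteP[F [TF ndF Foo]] := sigma_finiteT (@lebesgue_measure R).
have /sigma_finiteP[G [TG ndG Goo]] := sigma_finiteT mu.
exists (fun k => pair_uncons @^-1` (F k `*` G k)) => [|k].
  rewrite -preimage_bigcup (_ : \bigcup_k _ = setT) ?preimage_setT//.
  apply/seteqP; split=> // -[x y] _.
  have [k _ Fkx] : (\bigcup_k F k) x by rewrite -TF.
  have [l _ Gly] : (\bigcup_l G l) y by rewrite -TG.
  exists (maxn k l) => //; split.
  - by move: x Fkx; exact/subsetPset/ndF/leq_maxl.
  - by move: y Gly; exact/subsetPset/ndG/leq_maxr.
have [mF F_fin] := Foo k; have [mG G_fin] := Goo k; split.
  rewrite -[X in measurable X]setTI.
  by apply: measurable_pair_uncons => //; exact: measurableX.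
rewrite /cons_measure /pushforward -comp_preimage.
rewrite (_ : _ \o _ = id); last by apply/funext => p; exact: pair_consK.
by rewrite preimage_id product_measure1E// lte_mul_pinfty// ge0_fin_numE.
Qed.

HB.instance Definition _ := Measure_isSigmaFinite.Build _ _ _ cons_measure
  cons_measure_sigma_finite.

End tuple_cons_measure.

Section tuple_nil_measure.
Context (R : realType).
Let T := measurableTypeR R.

Definition nil_measure : set (0.-tuple T) -> \bar R := \d_([tuple] : 0.-tuple T).

HB.instance Definition _ := Measure.on nil_measure.

Let nil_measure_sigma_finite : sigma_finite setT nil_measure.
Proof.
exists (fun=> setT) => [|k]; first by rewrite bigcup_const.
by split=> //; rewrite /nil_measure diracT ltry.
Qed.

HB.instance Definition _ := Measure_isSigmaFinite.Build _ _ _ nil_measure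
  nil_measure_sigma_finite.

End tuple_nil_measure.

Fixpoint lebesgue_tuple (R : realType) (n : nat) :
    {sigma_finite_measure set (n.-tuple (measurableTypeR R)) -> \bar R} :=
  match n with
  | 0 => @nil_measure R
  | m.+1 => cons_measure (lebesgue_tuple R m)
  end.

(** [\int_D f dmu] and expectation for complex-valued functions, componentwise. *)

Section complex_integral.
Context d (T : measurableType d) (R : realType).

Definition cintegrable (mu : {measure set T -> \bar R}) (D : set T)
    (f : T -> R[i]) : Prop :=
  mu.-integrable D (fun x => (complex.Re (f x))%:E) /\
  mu.-integrable D (fun x => (complex.Im (f x))%:E).

Definition cintegral (mu : {measure set T -> \bar R}) (D : set T)
    (f : T -> R[i]) : R[i] :=
  (\int[mu]_(x in D) complex.Re (f x)) +i* (\int[mu]_(x in D) complex.Im (f x)).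

Definition cexpectation (P : probability T R) (X : T -> R[i]) : R[i] :=
  fine 'E_P[fun w => complex.Re (X w)] +i* fine 'E_P[fun w => complex.Im (X w)].

End complex_integral.

Section ensemble.
Context (R : realType) (M N : nat).
Implicit Types (Phi : 'I_M -> R -> R[i]) (Psi : 'I_N -> R -> R[i]).
Implicit Types (Psibar : 'I_N -> 'I_N -> R[i]) (xi : R -> R[i]).

(** The endpoints are extended reals, so that [alpha] and [beta] may be infinite. *)
Definition segment (alpha beta : \bar R) : set R :=
  [set x | (alpha <= x%:E)%E /\ (x%:E <= beta)%E].

Definition ordered_region (alpha beta : \bar R) :
    set (M.-tuple (measurableTypeR R)) :=
  [set x | (forall i, segment alpha beta (tnth x i)) /\
           (forall i j : 'I_M, (i <= j)%N -> tnth x j <= tnth x i)].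

Definition Phi_mx Phi (x : M.-tuple R) : 'M[R[i]]_M :=
  \matrix_(i, j) Phi i (tnth x j).

(** [insub j : option 'I_M] tells the first [M] column indices apart from the
    last [N - M]; only the columns [M <= j] of [Psibar] are used. *)
Definition Psi_mx Psi Psibar (x : M.-tuple R) : 'M[R[i]]_N :=
  \matrix_(i, j) match (insub (val j) : option 'I_M) with
                 | Some j' => Psi i (tnth x j')
                 | None => Psibar i j
                 end.

Definition jpdf (K : R[i]) Phi Psi Psibar xi (x : M.-tuple R) : R[i] :=
  K * \det (Phi_mx Phi x) * \det (Psi_mx Psi Psibar x)
    * \prod_(i < M) xi (tnth x i).

(** A complex-valued [f] is a p.d.f. on [D] if it is real and nonnegative there
    (which is what [0 <= f x] means in [R[i]]), measurable, of total mass 1. *)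
Definition is_pdf (D : set (M.-tuple (measurableTypeR R)))
    (f : M.-tuple R -> R[i]) : Prop :=
  [/\ forall x, D x -> 0 <= f x,
      measurable_fun D (fun x => complex.Re (f x) : measurableTypeR R) &
      (\int[lebesgue_tuple R M]_(x in D) (complex.Re (f x))%:E = 1)%E].

Definition tensor_integrand Phi Psi xi (phi : 'I_M -> R -> R[i])
    (i j : 'I_N) (k : 'I_M) (x : R) : R[i] :=
  match (insub (val i) : option 'I_M) with
  | Some i' => Phi i' x * Psi j x * xi x * phi k x
  | None => Psi j x * xi x * phi k x
  end.

Definition tensorA (alpha beta : \bar R) Phi Psi Psibar xi
    (phi : 'I_M -> R -> R[i]) (i j k : 'I_N) : R[i] :=
  match (insub (val k) : option 'I_M) with
  | Some k' => cintegral (@lebesgue_measure R) (segment alpha beta)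
                 (tensor_integrand Phi Psi xi phi i j k')
  | None => if (i < k)%N then 0 else Psibar j k
  end.

End ensemble.

Definition pseudo_det (C : comPzRingType) (N : nat)
    (a : 'I_N -> 'I_N -> 'I_N -> C) : C :=
  \sum_(mu : 'S_N) (-1) ^+ mu *
    \sum_(al : 'S_N) (-1) ^+ al * \prod_(k < N) a (mu k) (al k) k.

Section random_vectors.
Context d (Omega : measurableType d) (R : realType) (P : probability Omega R).
Context (M : nat).

Definition rvec (lambda : 'I_M -> {RV P >-> R}) (w : Omega) :
    M.-tuple (measurableTypeR R) :=
  [tuple lambda i w | i < M].

Definition has_pdf (lambda : 'I_M -> {RV P >-> R})
    (D : set (M.-tuple (measurableTypeR R))) (f : M.-tuple R -> R[i]) : Prop :=
  is_pdf D f /\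
  forall B : set (M.-tuple (measurableTypeR R)), measurable B ->
    (P (rvec lambda @^-1` B) =
     \int[lebesgue_tuple R M]_(x in B `&` D) (complex.Re (f x))%:E)%E.

Definition uniform_perm (sigma : Omega -> 'S_M) : Prop :=
  forall s : 'S_M, measurable (sigma @^-1` [set s]) /\
    P (sigma @^-1` [set s]) = ((M`!)%:R^-1)%:E.

Definition indep_perm (lambda : 'I_M -> {RV P >-> R})
    (sigma : Omega -> 'S_M) : Prop :=
  forall (B : set (M.-tuple (measurableTypeR R))) (s : 'S_M), measurable B ->
    P (rvec lambda @^-1` B `&` sigma @^-1` [set s]) =
    (P (rvec lambda @^-1` B) * P (sigma @^-1` [set s]))%E.

Definition unordered (lambda : 'I_M -> {RV P >-> R})
    (sigma : Omega -> 'S_M) (l : 'I_M) (w : Omega) : R :=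
  lambda (sigma w l) w.

End random_vectors.

(* Main.v *)
Require Import Defs.
From HB Require Import structures.
From mathcomp Require Import all_boot all_order all_algebra all_fingroup.
From mathcomp Require Import all_classical all_reals all_analysis.
From mathcomp Require Import complex.
From mathcomp Require Import measurable_realfun ring.

Set Implicit Arguments.
Unset Strict Implicit.
Unset Printing Implicit Defensive.

Import Order.TTheory GRing.Theory Num.Theory.
Import numFieldNormedType.Exports.

Local Open Scope classical_set_scope.
Local Open Scope ring_scope.
Local Open Scope complex_scope.

(** The expectation and the pseudo-determinant are two evaluations of the same
    integral over the whole cube of side [[alpha, beta]], that of the density,
    read as a function on the cube, times the product of the [phi k (x_k)].

    On the algebraic side, a tensor of the form [A i k * B j k * c k] has
    pseudo-determinant [\det A * \det B * \prod_k c k], because the two sums over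
    permutations separate ([pseudo_det_rank1]).  Before integration the tensor of
    the theorem has this form: [B] is the matrix [Psi], [c k] is [xi * phi k], and
    [A] is [Phi] bordered by a lower unitriangular block, which leaves its
    determinant unchanged ([det_extend]).  The zeros prescribed for [i < k] in the
    last columns are the zeros of that block.  Each term of the pseudo-determinant
    is a product of functions of one variable each, so Fubini's theorem
    integrates the terms separately and yields the pseudo-determinant of the
    integrated tensor ([cintegral_extended_integrand]).

    On the probabilistic side, conditioning on the permutation turns the
    expectation into an average over [s] of integrals over the ordered region of
    the density times the product of the [phi k (x_(s k))]
    ([cintegral_prod_phi_permute]).  The density is symmetric, since permuting the
    variables multiplies both determinants by the same sign, and Lebesgue measure
    is invariant under permutations of the coordinates.  So each of these
    integrals is the integral of one fixed function over one of the [M!]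
    reorderings of the ordered region.  These reorderings tile the cube, except
    for the points with two equal coordinates, where the density vanishes because
    [Phi] has two equal columns ([cintegral_sorted_pieces]).

    Measurability is known for the products [Phi i * Psi j * xi * phi k] and
    [Psi j * xi * phi k] on the segment, but not for [phi k] alone.  The change of
    variables from the probability space to the tuples is therefore stated for
    functions whose product with the density is integrable ([integral_density]). *)

(** * Integrals against weighted image measures *)

Lemma integral_mkindic d (T : measurableType d) (R : realType)
    (m : {measure set T -> \bar R}) (A : set T) (f : T -> R) :
  (\int[m]_(x in A) (f x)%:E = \int[m]_x (\1_A x * f x)%:E)%E.
Proof.
rewrite integral_mkcond; apply: eq_integral => x _.
by rewrite patchE indicE; case: ifP; rewrite ?mul1r ?mul0r.
Qed.

Lemma integrable_mkindic d (T : measurableType d) (R : realType)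
    (m : {measure set T -> \bar R}) (A : set T) (f : T -> R) : measurable A ->
  m.-integrable A (fun x => (f x)%:E) <->
  m.-integrable setT (fun x => (\1_A x * f x)%:E).
Proof.
move=> mA; rewrite (integrable_mkcond _ mA).
rewrite (_ : _ \_ _ = (fun x => (\1_A x * f x)%:E))//.
apply/funext => x.
by rewrite patchE indicE; case: ifP; rewrite ?mul1r ?mul0r.
Qed.

Import HBNNSimple.

Section composed_integrals.
Context d1 d (T1 : measurableType d1) (T : measurableType d) (R : realType).

(** The right-hand side depends on [X] and [w] only through the integrals of [w]
    over the preimages of measurable sets, that is, through the image by [X] of
    the measure of density [w]. *)
Lemma ge0_integral_comp_nnsfun (m : {measure set T1 -> \bar R}) (X : T1 -> T)
    (w : T1 -> R) (h : {nnsfun T >-> R}) :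
  measurable_fun setT X -> measurable_fun setT w -> (forall x, 0 <= w x) ->
  (\int[m]_x (h (X x) * w x)%:E =
   \sum_(r \in range h) r%:E * \int[m]_(x in X @^-1` (h @^-1` [set r])) (w x)%:E)%E.
Proof.
move=> mX mw w0.
have mA r : measurable (X @^-1` (h @^-1` [set r])).
  by rewrite -[X in measurable X]setTI; exact: mX.
(* The values of [h] are nonnegative, so they can enter the integrals. *)
have E r : (r \in range h ->
    r%:E * \int[m]_(x in X @^-1` (h @^-1` [set r])) (w x)%:E =
    \int[m]_x (r * \1_(h @^-1` [set r]) (X x) * w x)%:E)%E.
  move=> /[!inE] -[t _ hr].
  have r0 : 0 <= r by rewrite -hr.
  rewrite integral_mkindic -ge0_integralZl_EFin//; last 2 first.
  - by move=> x _; rewrite lee_fin mulr_ge0.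
  - by apply/measurable_EFinP/measurable_funM.
  by apply: eq_integral => x _; rewrite -EFinM mulrA.
under [RHS]eq_fsbigr do rewrite E//.
rewrite -ge0_integral_fsum//.
- apply: eq_integral => x _; rewrite fsumEFin//; congr EFin.
  rewrite {1}(fimfunE h) /=.
  by rewrite !fsbig_finite//= big_distrl.
- move=> r; apply/measurable_EFinP; apply: measurable_funM => //.
  apply: measurable_funM => //.
  exact: (measurableT_comp _ mX).
- by move=> r x _; rewrite lee_fin mulr_ge0//; exact: nnfun_muleindic_ge0.
Qed.

Lemma ge0_integral_comp_lim (m : {measure set T1 -> \bar R}) (X : T1 -> T)
    (w : T1 -> R) (h : T -> R) (mh : measurable_fun setT (EFin \o h)) :
  measurable_fun setT X -> measurable_fun setT w -> (forall x, 0 <= w x) ->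
  (forall x, 0 <= h x) ->
  (\int[m]_x (h (X x) * w x)%:E =
   limn (fun n => \int[m]_x (nnsfun_approx measurableT mh n (X x) * w x)%:E))%E.
Proof.
move=> mX mw w0 h0; rewrite -monotone_convergence//.
- apply: eq_integral => x _; apply/esym/cvg_lim => //.
  under eq_fun do rewrite EFinM muleC.
  rewrite EFinM muleC; apply: cvgeZl => //.
  by apply: cvg_nnsfun_approx => // *; rewrite lee_fin.
- move=> n; apply/measurable_EFinP/measurable_funM => //.
  exact: (measurableT_comp _ mX).
- by move=> n x _; rewrite lee_fin mulr_ge0.
- move=> x _ a b ab; rewrite lee_fin ler_wpM2r//.
  exact/lefP/nd_nnsfun_approx.
Qed.

End composed_integrals.

Section weighted_images.
Context d1 d2 d (T1 : measurableType d1) (T2 : measurableType d2)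
        (T : measurableType d) (R : realType).
Variables (m1 : {measure set T1 -> \bar R}) (m2 : {measure set T2 -> \bar R}).
Variables (X : T1 -> T) (Y : T2 -> T) (w : T1 -> R) (p : T2 -> R).
Hypotheses (mX : measurable_fun setT X) (mY : measurable_fun setT Y).
Hypotheses (mw : measurable_fun setT w) (mp : measurable_fun setT p).
Hypotheses (w0 : forall x, 0 <= w x) (p0 : forall y, 0 <= p y).
Hypothesis wp : forall B, measurable B ->
  (\int[m1]_(x in X @^-1` B) (w x)%:E = \int[m2]_(y in Y @^-1` B) (p y)%:E)%E.

(** By [wp], the measures of densities [w] and [p] have the same image in [T];
    simple functions have the same integral against both, and so do their
    monotone limits. *)
Lemma ge0_integral_weighted (h : T -> R) :
  measurable_fun setT h -> (forall t, 0 <= h t) ->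
  (\int[m1]_x (h (X x) * w x)%:E = \int[m2]_y (h (Y y) * p y)%:E)%E.
Proof.
move=> mh h0; have mh' : measurable_fun setT (EFin \o h) by exact/measurable_EFinP.
rewrite (ge0_integral_comp_lim _ mh')// (ge0_integral_comp_lim _ mh')//.
congr (limn _); apply/funext => n.
rewrite !ge0_integral_comp_nnsfun//; apply: eq_fsbigr => r _.
by rewrite wp.
Qed.

Lemma integral_weighted (h : T -> R) : measurable_fun setT h ->
  m2.-integrable setT (fun y => (h (Y y) * p y)%:E) ->
  m1.-integrable setT (fun x => (h (X x) * w x)%:E) /\
  (\int[m1]_x (h (X x) * w x)%:E = \int[m2]_y (h (Y y) * p y)%:E)%E.
Proof.
move=> mh /integrableP[mhp ihp].
(* Multiplying by a nonnegative weight commutes with taking the positive and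
   the negative part. *)
have posE (c : R) (a : R) : 0 <= c -> (maxe (a * c)%:E 0 = (Num.max a 0 * c)%:E)%E.
  by move=> c0; rewrite -EFin_max -[0 in LHS](mul0r c) maxr_pMl.
have negE (c : R) (a : R) : 0 <= c ->
    (maxe (- (a * c)%:E) 0 = (Num.max (- a) 0 * c)%:E)%E.
  by move=> c0; rewrite -EFinN -mulNr posE.
split.
  apply/integrableP; split.
    apply/measurable_EFinP/measurable_funM => //; exact: (measurableT_comp mh).
  move: ihp; under eq_integral do rewrite /= normrM (ger0_norm (p0 _)).
  under [X in _ -> (X < _)%E]eq_integral do rewrite /= normrM (ger0_norm (w0 _)).
  rewrite (ge0_integral_weighted (h := fun t => `|h t|))//.
  exact: measurableT_comp.
rewrite [LHS]integralE [RHS]integralE; congr (_ - _)%E.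
  under eq_integral do rewrite funeposE posE//.
  under [RHS]eq_integral do rewrite funeposE posE//.
  apply: (ge0_integral_weighted (h := fun t => Num.max (h t) 0)).
    by apply: measurable_maxr.
  by move=> t; rewrite le_max lexx orbT.
under eq_integral do rewrite funenegE negE//.
under [RHS]eq_integral do rewrite funenegE negE//.
apply: (ge0_integral_weighted (h := fun t => Num.max (- h t) 0)).
  by apply: measurable_maxr => //; exact: measurableT_comp.
by move=> t; rewrite le_max lexx orbT.
Qed.

End weighted_images.

Section density.
Context d1 d (T1 : measurableType d1) (T : measurableType d) (R : realType).
Variables (P : {measure set T1 -> \bar R}) (mu : {measure set T -> \bar R}).
Variables (X : T1 -> T) (E : set T1) (p : T -> R).
Hypotheses (mX : measurable_fun setT X) (mE : measurable E).
Hypotheses (mp : measurable_fun setT p) (p0 : forall x, 0 <= p x).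
Hypothesis XEp : forall B, measurable B ->
  (P (X @^-1` B `&` E) = \int[mu]_(x in B) (p x)%:E)%E.

(** On the set where [p] vanishes [h] is arbitrary, possibly not measurable.
    [X] almost surely avoids that set on [E], and off it [h] is the quotient of
    the measurable functions [h * p] and [p]; so [h] may be replaced by that
    quotient. *)
Lemma integral_density (h : T -> R) :
  P.-integrable E (fun w => (h (X w))%:E) ->
  mu.-integrable setT (fun x => (h x * p x)%:E) ->
  (\int[P]_(w in E) (h (X w))%:E = \int[mu]_x (h x * p x)%:E)%E.
Proof.
move=> iX ihp.
(* The inverse, with the convention that the inverse of 0 is 0. *)
pose h' x := h x * p x * p x `^ (-1).
have h'E x : h' x = h x * p x * (p x)^-1 by rewrite /h' powR_inv1.
have h'p x : h' x * p x = h x * p x.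
  rewrite h'E; have [->|px0] := eqVneq (p x) 0; first by rewrite !mulr0.
  by rewrite divfK.
have mh' : measurable_fun setT h'.
  apply: measurable_funM; first by apply/measurable_EFinP/(measurable_int mu).
  exact: (measurableT_comp (measurable_powR _) mp).
have mXB B : measurable B -> measurable (X @^-1` B).
  by move=> mB; rewrite -[X in measurable X]setTI; exact: mX.
have mE1 : measurable_fun setT (\1_E : T1 -> R) by exact: measurable_indic.
have wp B : measurable B ->
    (\int[P]_(w in X @^-1` B) (\1_E w)%:E = \int[mu]_(x in id @^-1` B) (p x)%:E)%E.
  by move=> mB; rewrite integral_indic; [rewrite setIC XEp|exact: mXB|].
have mE0 w : 0 <= \1_E w :> R by rewrite indicE.
have [|ih' E'] := @integral_weighted _ _ _ _ _ _ _ P mu X id \1_E p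
  mX (@measurable_id _ T setT) mE1 mp mE0 p0 wp h' mh'.
- by under eq_fun do rewrite /= h'p.
under [RHS]eq_integral do rewrite -h'p.
rewrite -E' integral_mkindic; apply: ae_eq_integral => //.
- by move/(integrable_mkindic _ _ mE)/measurable_int : iX.
- exact: measurable_int ih'.
have mp0 : measurable (p @^-1` [set 0]).
  by rewrite -[X in measurable X]setTI; exact: mp.
exists (X @^-1` (p @^-1` [set 0]) `&` E); split.
- by apply: measurableI => //; exact: mXB.
- rewrite XEp//; apply: integral0_eq => x px; by rewrite px.
move=> w /= /not_implyP[_ hw]; split; last first.
  by apply: contrapT => nE; apply: hw; rewrite indicE memNset// mulr0 mul0r.
apply: contrapT => /eqP pX0; apply: hw.
by rewrite h'E mulfK// mulrC.
Qed.

End density.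

(** * Boxes and permutations of coordinates *)

Section lebesgue_boxes.
Context (R : realType).
Notation T := (measurableTypeR R).

Definition box n (A : 'I_n -> set T) : set (n.-tuple T) :=
  [set t | forall i, A i (tnth t i)].

Lemma measurable_box n (A : 'I_n -> set T) :
  (forall i, measurable (A i)) -> measurable (box A).
Proof.
move=> mA; rewrite (_ : box A = \bigcap_(i in [set: 'I_n]) ((@tnth n T)^~ i @^-1` A i)).
  apply: fin_bigcap_measurable => // i _.
  by rewrite -[X in measurable X]setTI; exact: measurable_tnth.
by apply/seteqP; split=> t /= At i //=; exact: At.
Qed.

Lemma lebesgue_tuple_box n (A : 'I_n -> set T) : (forall i, measurable (A i)) ->
  (lebesgue_tuple R n (box A) = \prod_(i < n) lebesgue_measure (A i))%E.
Proof.
elim: n A => [|n IH] A mA /=.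
  rewrite big_ord0 /nil_measure diracE mem_set//.
  by move=> [].
rewrite big_ord_recl -IH => [|i]; last exact: mA.
rewrite /cons_measure /pushforward.
rewrite (_ : _ @^-1` _ = A ord0 `*` box (fun i => A (lift ord0 i))).
  by rewrite product_measure1E//; exact: measurable_box.
apply/seteqP; split=> -[x t] /=.
  by move=> At; split; [exact: (At ord0)|move=> i; rewrite -[tnth _ _](tnthS x) //; exact: At].
move=> [Ax At] i; case: (unliftP ord0 i) => [j ->|->]; last by [].
by rewrite tnthS; exact: At.
Qed.

(** Measurable tuples are generated by the preimages of coordinates, which are
    boxes with a single constraint.  Unlike these preimages, boxes are stable
    under intersection, as uniqueness of measures requires. *)
Lemma measurable_tuple_boxes n :
  @measurable _ (n.-tuple T) = <<s [set box A | A in [set A | forall i, measurable (A i)]] >>.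
Proof.
apply/seteqP; split.
  apply: smallest_sub; first exact: smallest_sigma_algebra.
  move=> B; rewrite -bigcup_seq => -[i _ [C mC <-]].
  apply: sub_sigma_algebra; exists (fun j => if j == i then C else setT) => /=.
    by move=> j; case: ifP.
  apply/seteqP; split=> t /=.
    by move=> /(_ i); rewrite eqxx.
  by move=> [_ Ct] j; case: ifP => // /eqP ->.
apply: smallest_sub; first exact: sigma_algebra_measurable.
by move=> _ [A mA <-]; exact: measurable_box.
Qed.

Definition permute n (s : 'S_n) (t : n.-tuple T) : n.-tuple T :=
  [tuple tnth t (s i) | i < n].

Lemma tnth_permute n (s : 'S_n) t i : tnth (permute s t) i = tnth t (s i).
Proof. by rewrite tnth_mktuple. Qed.

Lemma permuteM n (s t : 'S_n) (x : n.-tuple T) :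
  permute t (permute s x) = permute (t * s)%g x.
Proof. by apply: eq_from_tnth => i; rewrite !tnth_permute permM. Qed.

Lemma permute1 n (x : n.-tuple T) : permute 1%g x = x.
Proof. by apply: eq_from_tnth => i; rewrite tnth_permute perm1. Qed.

Lemma box_permute n (s : 'S_n) (A : set T) (x : n.-tuple T) :
  box (fun=> A) (permute s x) <-> box (fun=> A) x.
Proof.
split=> xA i; last by rewrite tnth_permute; exact: xA.
by have := xA ((s^-1)%g i); rewrite tnth_permute permKV.
Qed.

Lemma measurable_permute n (s : 'S_n) : measurable_fun setT (permute s).
Proof.
apply/measurable_fun_tnthP => i.
rewrite (_ : _ \o _ = (@tnth n T)^~ (s i)); first exact: measurable_tnth.
by apply/funext => t /=; rewrite tnth_permute.
Qed.

Lemma preimage_permute_box n (s : 'S_n) A :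
  permute s @^-1` box A = box (fun i => A ((s^-1)%g i)).
Proof.
apply/seteqP; split=> t /= At i.
  by have := At ((s^-1)%g i); rewrite tnth_permute permKV.
by have := At (s i); rewrite tnth_permute permK.
Qed.

(** Two measures that agree on boxes are equal, and permuting the coordinates
    permutes the factors of the volume of a box. *)
Lemma lebesgue_tuple_permute n (s : 'S_n) B : measurable B ->
  lebesgue_tuple R n (permute s @^-1` B) = lebesgue_tuple R n B.
Proof.
move=> mB.
apply/esym.
pose tau : {mfun n.-tuple T >-> n.-tuple T} :=
  HB.pack (permute s) (isMeasurableFun.Build _ _ _ _ _ (measurable_permute s)).
apply: (@measure_unique _ R _ [set box A | A in [set A | forall i, measurable (A i)]]
   (fun k => box (fun _ => `[- k%:R, k%:R]%classic)) _ _ _ _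
   (lebesgue_tuple R n) (pushforward (lebesgue_tuple R n) tau)) => //.
- exact: measurable_tuple_boxes.
- move=> _ _ [A mA <-] [A' mA' <-]; exists (fun i => A i `&` A' i).
    by move=> i; exact: measurableI.
  apply/seteqP; split=> t /=; first by move=> At; split=> i; case: (At i).
  by move=> [At A't] i; split.
- by move=> k; exists (fun=> `[- k%:R, k%:R]%classic).
- apply/seteqP; split=> // t _.
  exists (\max_(i < n) (Num.truncn `|tnth t i|).+1)%N => // i /=.
  rewrite in_itv /= -ler_norml.
  apply: (le_trans (ltW (truncnS_gt _))).
  rewrite ler_nat.
  exact: (leq_bigmax_cond (F := fun i => (Num.truncn `|tnth t i|).+1)).
- move=> _ [A mA <-] /=.
  rewrite /pushforward preimage_permute_box !lebesgue_tuple_box//.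
  by rewrite [RHS](reindex_inj (@perm_inj _ s)) /=; under [RHS]eq_bigr do rewrite permK.
- move=> k.
  pose C : set T := `[- k%:R, k%:R]%classic.
  suff : (lebesgue_tuple R n (box (fun=> C)) < +oo)%E by [].
  rewrite lebesgue_tuple_box//.
  suff /andP[//] : (0 <= \prod_(i < n) lebesgue_measure C < +oo)%E.
  apply: (big_ind (fun x => 0 <= x < +oo)%E) => [|x y /andP[x0 xoo] /andP[y0 yoo]|i _].
  + by rewrite lee01 ltry.
  + by rewrite mule_ge0// lte_mul_pinfty// ge0_fin_numE.
  + by rewrite measure_ge0/= lebesgue_measure_itv/=; case: ifP => _; rewrite ltry.
  + by move=> _; exact: measurable_itv.
Qed.

End lebesgue_boxes.

(** * Complex-valued integrals *)

Section complex_parts.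
Context (R : realType).
Implicit Types (z : R[i]) (r : R).

Lemma complexReM z1 z2 : complex.Re (z1 * z2) =
  complex.Re z1 * complex.Re z2 - complex.Im z1 * complex.Im z2.
Proof. by case: z1 z2 => a b [c e]. Qed.

Lemma complexImM z1 z2 : complex.Im (z1 * z2) =
  complex.Re z1 * complex.Im z2 + complex.Im z1 * complex.Re z2.
Proof. by case: z1 z2 => a b [c e]. Qed.

Lemma complexReMr r z : complex.Re (r%:C * z) = r * complex.Re z.
Proof. by rewrite complexReM /= mul0r subr0. Qed.

Lemma complexImMr r z : complex.Im (r%:C * z) = r * complex.Im z.
Proof. by rewrite complexImM /= mul0r addr0. Qed.

Lemma complexReD z1 z2 : complex.Re (z1 + z2) = complex.Re z1 + complex.Re z2.
Proof. by case: z1 z2 => a b []. Qed.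

Lemma complexImD z1 z2 : complex.Im (z1 + z2) = complex.Im z1 + complex.Im z2.
Proof. by case: z1 z2 => a b []. Qed.

End complex_parts.

Section complex_integrals.
Context d (T : measurableType d) (R : realType).
Variable (m : {measure set T -> \bar R}).
Implicit Types (f g : T -> R[i]) (A : set T).

Lemma eq_cintegrable A f g : measurable A -> {in A, f =1 g} ->
  cintegrable m A f -> cintegrable m A g.
Proof.
by move=> mA fg [fr fi]; split; [move: fr|move: fi];
  apply: eq_integrable => // x xA; rewrite fg.
Qed.

Lemma eq_cintegral A f g : {in A, f =1 g} -> cintegral m A f = cintegral m A g.
Proof.
by move=> fg; congr (_ +i* _); apply: eq_Rintegral => x xA; rewrite fg.
Qed.

Lemma cintegrable_mkindic A f : measurable A ->
  cintegrable m A f <-> cintegrable m setT (fun x => (\1_A x)%:C * f x).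
Proof.
move=> mA; rewrite /cintegrable (integrable_mkindic _ (fun x => complex.Re (f x)) mA).
rewrite (integrable_mkindic _ (fun x => complex.Im (f x)) mA).
have -> : (fun x => (complex.Re ((\1_A x)%:C * f x))%:E) =
    (fun x => (\1_A x * complex.Re (f x))%:E).
  by apply/funext => x; rewrite complexReMr.
by have -> : (fun x => (complex.Im ((\1_A x)%:C * f x))%:E) =
    (fun x => (\1_A x * complex.Im (f x))%:E);
  first by apply/funext => x; rewrite complexImMr.
Qed.

Lemma cintegral_mkindic A f :
  cintegral m A f = cintegral m setT (fun x => (\1_A x)%:C * f x).
Proof.
congr (fine _ +i* fine _); rewrite integral_mkindic; apply: eq_integral => x _.
  by rewrite complexReMr.
by rewrite complexImMr.
Qed.

Lemma cintegrable_indicM A f : measurable A -> cintegrable m setT f ->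
  cintegrable m setT (fun x => (\1_A x)%:C * f x).
Proof.
move=> mA [fr fi]; apply/(cintegrable_mkindic _ mA).
by split; apply: (integrableS measurableT).
Qed.

Lemma cintegral0 A : cintegral m A (fun=> 0) = 0.
Proof. by rewrite /cintegral /Rintegral !integral0. Qed.

Lemma cintegrable0 A : measurable A -> cintegrable m A (fun=> 0).
Proof. by move=> mA; split; exact: integrable0. Qed.

Lemma cintegrableD f g : cintegrable m setT f -> cintegrable m setT g ->
  cintegrable m setT (fun x => f x + g x).
Proof.
move=> [fr fi] [gr gi]; split.
  by under eq_fun do rewrite complexReD EFinD; exact: integrableD.
by under eq_fun do rewrite complexImD EFinD; exact: integrableD.
Qed.

Lemma cintegralD f g : cintegrable m setT f -> cintegrable m setT g ->
  cintegral m setT (fun x => f x + g x) = cintegral m setT f + cintegral m setT g.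
Proof.
move=> [fr fi] [gr gi]; rewrite /cintegral.
under eq_Rintegral do rewrite complexReD.
under [X in _ +i* X]eq_Rintegral do rewrite complexImD.
by rewrite !RintegralD.
Qed.

Lemma cintegrableZ (c : R[i]) f : cintegrable m setT f ->
  cintegrable m setT (fun x => c * f x).
Proof.
move=> [fr fi]; split.
  under eq_fun do rewrite complexReM EFinB !EFinM.
  by apply: integrableB => //; exact: integrableZl.
under eq_fun do rewrite complexImM EFinD !EFinM.
by apply: integrableD => //; exact: integrableZl.
Qed.

Lemma cintegralZ (c : R[i]) f : cintegrable m setT f ->
  cintegral m setT (fun x => c * f x) = c * cintegral m setT f.
Proof.
move=> [fr fi]; rewrite /cintegral.
under eq_Rintegral do rewrite complexReM.
under [X in _ +i* X]eq_Rintegral do rewrite complexImM.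
have iZ (r : R) (h : T -> R) : m.-integrable setT (fun x => (h x)%:E) ->
    m.-integrable setT (fun x => (r * h x)%:E).
  by move=> ih; under eq_fun do rewrite EFinM; exact: integrableZl.
rewrite RintegralB// ?RintegralD//; try exact: iZ.
by rewrite !RintegralZl//; case: c.
Qed.

Lemma cintegrable_sum (I : Type) (r : seq I) (F : I -> T -> R[i]) :
  (forall i, cintegrable m setT (F i)) ->
  cintegrable m setT (fun x => \sum_(i <- r) F i x).
Proof.
move=> iF; elim: r => [|i r IH].
  by under eq_fun do rewrite big_nil; exact: cintegrable0.
by under eq_fun do rewrite big_cons; exact: cintegrableD.
Qed.

Lemma cintegral_sum (I : Type) (r : seq I) (F : I -> T -> R[i]) :
  (forall i, cintegrable m setT (F i)) ->
  cintegral m setT (fun x => \sum_(i <- r) F i x) =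
  \sum_(i <- r) cintegral m setT (F i).
Proof.
move=> iF; elim: r => [|i r IH].
  by rewrite big_nil -[RHS](cintegral0 setT); apply: eq_cintegral => x _; rewrite big_nil.
rewrite big_cons -IH -cintegralD//; last exact: cintegrable_sum.
by apply: eq_cintegral => x _; rewrite big_cons.
Qed.

End complex_integrals.

(** * Fubini's theorem for products of functions of one variable *)

Section product_integrals.
Context d1 d2 (T1 : measurableType d1) (T2 : measurableType d2) (R : realType).
Variables (m1 : {sigma_finite_measure set T1 -> \bar R}).
Variables (m2 : {sigma_finite_measure set T2 -> \bar R}).

Lemma integrable_tensor (u : T1 -> R) (v : T2 -> R) :
  m1.-integrable setT (EFin \o u) -> m2.-integrable setT (EFin \o v) ->
  (m1 \x m2)%E.-integrable setT (fun x => (u x.1 * v x.2)%:E).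
Proof.
move=> iu iv.
have mu : measurable_fun setT u by apply/measurable_EFinP/(measurable_int m1).
have mv : measurable_fun setT v by apply/measurable_EFinP/(measurable_int m2).
apply/integrable12ltyP.
  apply/measurable_EFinP/measurable_funM.
    exact: (measurableT_comp mu measurable_fst).
  exact: (measurableT_comp mv measurable_snd).
have iv' := integrable_fin_num measurableT (integrable_norm iv).
have -> : (\int[m1]_x \int[m2]_y `|(u (x, y).1 * v (x, y).2)%:E| =
    \int[m1]_x (`|u x|%:E * (fine (\int[m2]_y `|v y|%:E))%:E))%E.
  apply: eq_integral => x _.
  rewrite fineK// -ge0_integralZl_EFin//; last exact/measurable_EFinP/measurableT_comp.
  by apply: eq_integral => y _ /=; rewrite normrM EFinM.
rewrite integralZr//; last exact: integrable_norm.
by rewrite -(fineK (integrable_fin_num measurableT (integrable_norm iu))) -EFinM ltry.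
Qed.

Lemma Rintegral_tensor (u : T1 -> R) (v : T2 -> R) :
  m1.-integrable setT (EFin \o u) -> m2.-integrable setT (EFin \o v) ->
  Rintegral (m1 \x m2)%E setT (fun x => u x.1 * v x.2) =
  Rintegral m1 setT u * Rintegral m2 setT v.
Proof.
move=> iu iv; rewrite /Rintegral -integral12_prod_meas1; last exact: integrable_tensor.
rewrite -fineM; [|exact: integrable_fin_num..].
congr fine.
rewrite -(fineK (integrable_fin_num measurableT iv)) -integralZr//.
apply: eq_integral => x _; rewrite fineK ?integrable_fin_num//.
by rewrite -integralZl//.
Qed.

Lemma cintegrable_tensor (u : T1 -> R[i]) (v : T2 -> R[i]) :
  cintegrable m1 setT u -> cintegrable m2 setT v ->
  cintegrable (m1 \x m2)%E setT (fun x => u x.1 * v x.2).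
Proof.
move=> [ur ui] [vr vi]; split.
  under eq_fun do rewrite complexReM EFinB.
  by apply: integrableB => //;
    [exact: (integrable_tensor ur vr)|exact: (integrable_tensor ui vi)].
under eq_fun do rewrite complexImM EFinD.
by apply: integrableD => //;
  [exact: (integrable_tensor ur vi)|exact: (integrable_tensor ui vr)].
Qed.

Lemma cintegral_tensor (u : T1 -> R[i]) (v : T2 -> R[i]) :
  cintegrable m1 setT u -> cintegrable m2 setT v ->
  cintegral (m1 \x m2)%E setT (fun x => u x.1 * v x.2) =
  cintegral m1 setT u * cintegral m2 setT v.
Proof.
move=> [ur ui] [vr vi]; rewrite /cintegral.
under eq_Rintegral do rewrite complexReM.
under [X in _ +i* X]eq_Rintegral do rewrite complexImM.
rewrite RintegralB//; [|exact: (integrable_tensor ur vr)|exact: (integrable_tensor ui vi)].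
rewrite RintegralD//; [|exact: (integrable_tensor ur vi)|exact: (integrable_tensor ui vr)].
rewrite (Rintegral_tensor ur vr) (Rintegral_tensor ui vi).
by rewrite (Rintegral_tensor ur vi) (Rintegral_tensor ui vr).
Qed.

End product_integrals.

Section tuple_integrals.
Context (R : realType).
Notation T := (measurableTypeR R).

Lemma pair_unconsK n : cancel (@pair_uncons R n) (@pair_cons R n).
Proof. by move=> t; rewrite [RHS]tuple_eta. Qed.

(** Measurability of [f] comes for free: [f] is the composition of
    [f \o pair_cons] with the measurable inverse of [pair_cons]. *)
Lemma cintegral_cons n (f : n.+1.-tuple T -> R[i]) :
  cintegrable (@lebesgue_measure R \x lebesgue_tuple R n)%E setT (f \o @pair_cons R n) ->
  cintegrable (lebesgue_tuple R n.+1) setT f /\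
  cintegral (lebesgue_tuple R n.+1) setT f =
  cintegral (@lebesgue_measure R \x lebesgue_tuple R n)%E setT (f \o @pair_cons R n).
Proof.
have real (g : n.+1.-tuple T -> R) :
    (@lebesgue_measure R \x lebesgue_tuple R n)%E.-integrable setT
      (fun x => (g (pair_cons x))%:E) ->
    (lebesgue_tuple R n.+1).-integrable setT (fun x => (g x)%:E) /\
    Rintegral (lebesgue_tuple R n.+1) setT g =
    Rintegral (@lebesgue_measure R \x lebesgue_tuple R n)%E setT (g \o @pair_cons R n).
  move=> ig.
  have mg : measurable_fun setT (fun t => (g t)%:E).
    have -> : (fun t => (g t)%:E) =
        (fun x => (g (pair_cons x))%:E) \o @pair_uncons R n.
      by apply/funext => t /=; rewrite pair_unconsK.
    exact: measurableT_comp (measurable_int _ ig) (@measurable_pair_uncons R n).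
  have mc := @measurable_pair_cons R n.
  split; first exact: (integrable_pushforward mc mg ig).
  by congr fine; rewrite (integral_pushforward mc mg ig).
move=> [fr fi]; have [fr' Er] := real (fun x => complex.Re (f x)) fr.
have [fi' Ei] := real (fun x => complex.Im (f x)) fi.
by split=> //; rewrite /cintegral Er Ei.
Qed.

Lemma cintegral_tuple_prod n (h : 'I_n -> T -> R[i]) :
  (forall i, cintegrable (@lebesgue_measure R) setT (h i)) ->
  cintegrable (lebesgue_tuple R n) setT (fun t => \prod_(i < n) h i (tnth t i)) /\
  cintegral (lebesgue_tuple R n) setT (fun t => \prod_(i < n) h i (tnth t i)) =
  \prod_(i < n) cintegral (@lebesgue_measure R) setT (h i).
Proof.
elim: n h => [|n IH] h ih.
  have E : (fun t : 0.-tuple T => \prod_(i < 0) h i (tnth t i)) = cst 1.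
    by apply/funext => t; rewrite big_ord0.
  have m1 : @nil_measure R setT = 1%E by exact: diracT.
  have cI (r : R) : (@nil_measure R).-integrable setT (fun=> r%:E).
    apply/integrableP; split; first exact: measurable_cst.
    by rewrite integral_cst//= (_ : nil_measure setT = 1%E)// mule1 ltry.
  have cE (r : R) : Rintegral (@nil_measure R) setT (cst r) = r.
    by rewrite Rintegral_cst// -[RHS]mulr1; congr (_ * _); exact: (congr1 fine m1).
  rewrite big_ord0 E; split; first by split; exact: cI.
  by transitivity ((1 : R) +i* 0) => //; congr (_ +i* _); exact: cE.
have [iv Ev] := IH (fun i => h (lift ord0 i)) (fun i => ih _).
pose f (t : n.+1.-tuple T) := \prod_(i < n.+1) h i (tnth t i).
have fE : f \o @pair_cons R n =
    fun x => h ord0 x.1 * \prod_(i < n) h (lift ord0 i) (tnth x.2 i).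
  apply/funext => -[x t]; rewrite /f /= big_ord_recl; congr (_ * _).
  by apply: eq_bigr => i _; rewrite tnthS.
have [|if_ Ef] := @cintegral_cons n f.
  by rewrite fE; exact: (cintegrable_tensor (ih ord0) iv).
split=> //; rewrite Ef fE big_ord_recl -Ev.
exact: (cintegral_tensor (ih ord0) iv).
Qed.

Lemma cintegral_permute n (s : 'S_n) (f : n.-tuple T -> R[i]) :
  cintegrable (lebesgue_tuple R n) setT f ->
  cintegrable (lebesgue_tuple R n) setT (f \o permute s) /\
  cintegral (lebesgue_tuple R n) setT (f \o permute s) =
  cintegral (lebesgue_tuple R n) setT f.
Proof.
have real (g : n.-tuple T -> R) :
    (lebesgue_tuple R n).-integrable setT (fun x => (g x)%:E) ->
    (lebesgue_tuple R n).-integrable setT (fun x => (g (permute s x))%:E) /\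
    Rintegral (lebesgue_tuple R n) setT (g \o permute s) =
    Rintegral (lebesgue_tuple R n) setT g.
  move=> ig.
  have mg : measurable_fun setT g by apply/measurable_EFinP; exact: measurable_int ig.
  have ms := @measurable_permute R n s.
  have wp B : measurable B ->
      (\int[lebesgue_tuple R n]_(x in permute s @^-1` B) (cst 1 x : R)%:E =
       \int[lebesgue_tuple R n]_(x in id @^-1` B) (cst 1 x : R)%:E)%E.
    have cE C : measurable C ->
        (\int[lebesgue_tuple R n]_(x in C) (cst 1 x : R)%:E = lebesgue_tuple R n C)%E.
      by move=> mC; rewrite (eq_integral (cst 1%E))// integral_cst// mul1e.
    move=> mB; rewrite !cE//; first by rewrite lebesgue_tuple_permute.
    by rewrite -[X in measurable X]setTI; exact: ms.
  have [|igs Es] := @integral_weighted _ _ _ _ _ _ _ (lebesgue_tuple R n)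
    (lebesgue_tuple R n) (permute s) id (cst 1) (cst 1) ms (@measurable_id _ _ setT)
    (measurable_cst _) (measurable_cst _) (fun=> ler01) (fun=> ler01) wp g mg.
    by under eq_fun do rewrite /= mulr1.
  split; first by move: igs; under eq_fun do rewrite /= mulr1.
  congr fine; move: Es; under eq_integral do rewrite /= mulr1.
  by under [X in _ = X -> _]eq_integral do rewrite /= mulr1.
move=> [fr fi]; have [fr' Er] := real (fun x => complex.Re (f x)) fr.
have [fi' Ei] := real (fun x => complex.Im (f x)) fi.
by split=> //; rewrite /cintegral Er Ei.
Qed.

End tuple_integrals.

(** * Determinants *)

Section determinants.

(** In each term the sums over the two permutations are independent, so they
    factor into two determinants. *)
Lemma pseudo_det_rank1 (C : comNzRingType) N (A B : 'M[C]_N) (c : 'I_N -> C) :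
  pseudo_det (fun i j k => A i k * B j k * c k) =
  \det A * \det B * \prod_(k < N) c k.
Proof.
have detE (D : 'M[C]_N) : \det D = \sum_(s : 'S_N) (-1) ^+ s * \prod_(k < N) D (s k) k.
  by rewrite -det_tr; apply: eq_bigr => s _; congr (_ * _); apply: eq_bigr => k _; rewrite mxE.
rewrite -mulrA (detE A) (detE B) mulr_suml; apply: eq_bigr => m _.
rewrite -[RHS]mulrA; congr (_ * _); rewrite mulr_suml mulr_sumr.
apply: eq_bigr => a _; rewrite !big_split/= !mulrA; congr (_ * _).
by rewrite -mulrA mulrCA mulrA.
Qed.

Lemma insub_lshift M r (i : 'I_M) : insub (val (lshift r i)) = Some i :> option 'I_M.
Proof. exact: (valK i). Qed.

Lemma insub_rshift M r (i : 'I_r) : insub (val (rshift M i)) = None :> option 'I_M.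
Proof. by rewrite insubN//= -leqNgt leq_addr. Qed.

Lemma prod_insub (C : comNzRingType) M N (leMN : (M <= N)%N)
    (u : 'I_N -> 'I_M -> C) (v : 'I_N -> C) :
  \prod_(k < N) (if (insub (val k) : option 'I_M) is Some k' then u k k' else v k) =
  \prod_(k < M) u (widen_ord leMN k) k *
  \prod_(k < N | (M <= k)%N) v k.
Proof.
have E := subnKC leMN; move: (N - M)%N E => r E; subst N.
rewrite big_split_ord; congr (_ * _).
  apply: eq_bigr => k _; rewrite insub_lshift; congr u.
  exact/val_inj.
rewrite [RHS]big_split_ord -[LHS]mul1r; congr (_ * _).
  by rewrite big_pred0// => k; rewrite leqNgt /= ltn_ord.
by apply: eq_big => k; rewrite ?insub_rshift//= leq_addr.
Qed.

(** Bordering [A] by the columns of a lower unitriangular matrix makes a block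
    lower triangular matrix; the ones below [A] are arbitrary, and are chosen to
    match the tensor of the theorem, whose integrands have no factor [Phi] when
    [i] exceeds [M]. *)
Lemma det_extend (C : comNzRingType) M N (leMN : (M <= N)%N) (A : 'M[C]_M) :
  \det (\matrix_(i < N, k < N)
    match (insub (val k) : option 'I_M) with
    | Some k' => if (insub (val i) : option 'I_M) is Some i' then A i' k' else 1
    | None => if (i < k)%N then 0 else 1
    end) = \det A.
Proof.
move: (subnKC leMN); move: (N - M)%N => r E; subst N => {leMN}.
set B := \matrix_(_, _) _.
pose L : 'M[C]_r := \matrix_(i, k) if (i < k)%N then 0 else 1.
have -> : B = block_mx A 0 (const_mx 1) L.
  apply/matrixP => i k; case: (split_ordP i) => i' ->; case: (split_ordP k) => k' ->.
  - by rewrite block_mxEul mxE !insub_lshift.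
  - by rewrite block_mxEur !mxE insub_rshift/= (leq_trans (ltn_ord i'))// leq_addr.
  - by rewrite block_mxEdl !mxE insub_lshift insub_rshift.
  - by rewrite block_mxEdr !mxE insub_rshift/= ltn_add2l.
rewrite det_lblock [\det L]det_trig; last by apply/is_trig_mxP => i j ij; rewrite mxE ij.
by rewrite big1 ?mulr1// => i _; rewrite mxE ltnn.
Qed.

End determinants.

Section density_symmetry.
Context (R : realType) (M N : nat).
Variables (Phi : 'I_M -> R -> R[i]) (Psi : 'I_N -> R -> R[i]).
Variables (Psibar : 'I_N -> 'I_N -> R[i]) (xi : R -> R[i]) (K : R[i]).
Implicit Types (s : 'S_M) (x : M.-tuple R).

Lemma det_Phi_permute s x :
  \det (Phi_mx Phi (permute s x)) = (-1) ^+ s * \det (Phi_mx Phi x).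
Proof.
have -> : Phi_mx Phi (permute s x) = col_perm s (Phi_mx Phi x).
  by apply/matrixP => i j; rewrite !mxE tnth_permute.
by rewrite col_permE det_mulmx det_perm odd_permV mulrC.
Qed.

(** Only the first [M] columns move, so the sign is that of a permutation matrix
    completed by an identity block, which is [(-1) ^+ s]. *)
Lemma det_Psi_permute (leMN : (M <= N)%N) s x :
  \det (Psi_mx Psi Psibar (permute s x)) = (-1) ^+ s * \det (Psi_mx Psi Psibar x).
Proof.
move: Psi Psibar (subnKC leMN); move: (N - M)%N => r P Pb E; subst N => {leMN}.
have PE (y : M.-tuple R) : Psi_mx P Pb y =
    row_mx (\matrix_(i, j) P i (tnth y j)) (\matrix_(i, j) Pb i (rshift M j)).
  apply/matrixP => i j; case: (split_ordP j) => j' ->.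
  - by rewrite row_mxEl !mxE insub_lshift.
  - by rewrite row_mxEr !mxE insub_rshift.
have -> : Psi_mx P Pb (permute s x) =
    Psi_mx P Pb x *m block_mx (perm_mx s^-1) 0 0 1%:M.
  rewrite !PE mul_row_block !mulmx0 addr0 add0r mulmx1 -col_permE.
  by congr row_mx; apply/matrixP => i j; rewrite !mxE tnth_permute.
by rewrite det_mulmx det_ublock det1 mulr1 det_perm odd_permV mulrC.
Qed.

(** The signs of the two determinants cancel. *)
Lemma jpdf_permute (leMN : (M <= N)%N) s x :
  jpdf K Phi Psi Psibar xi (permute s x) = jpdf K Phi Psi Psibar xi x.
Proof.
rewrite /jpdf det_Phi_permute det_Psi_permute//.
have -> : \prod_(i < M) xi (tnth (permute s x) i) = \prod_(i < M) xi (tnth x i).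
  rewrite [RHS](reindex_inj (@perm_inj _ s)); apply: eq_bigr => i _.
  by rewrite tnth_permute.
have : (-1) ^+ s * (-1) ^+ s = 1 :> R[i] by rewrite -signr_addb addbb.
move: ((-1) ^+ s) (\det (Phi_mx Phi x)) (\det (Psi_mx Psi Psibar x)).
move=> e a b e2; rewrite (_ : K * (e * a) * (e * b) = (e * e) * (K * a * b)).
  by rewrite e2 mul1r.
by ring.
Qed.

(** [Phi] then has two equal columns. *)
Lemma jpdf_tie x (i j : 'I_M) : i != j -> tnth x i = tnth x j ->
  jpdf K Phi Psi Psibar xi x = 0.
Proof.
move=> ij xij; rewrite /jpdf -(det_tr (Phi_mx Phi x)).
rewrite (determinant_alternate ij); last by move=> k; rewrite !mxE xij.
by rewrite mulr0 !mul0r.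
Qed.

End density_symmetry.

(** * The ordered region *)

Section sorting.
Context (R : realType) (M : nat).
Context (alpha beta : \bar R).
Notation T := (measurableTypeR R).
Notation S := (segment alpha beta : set T).
Notation D := (@ordered_region R M alpha beta).

Lemma measurable_segment : measurable S.
Proof.
have -> : S = (setT `&` [set x : T | (cst alpha x <= x%:E)%E]) `&`
    (setT `&` [set x | (x%:E <= cst beta x)%E]).
  by apply/seteqP; split=> [x []|x [[_ ?] [_ ?]]].
by apply: measurableI; apply: measurable_lee => //; exact/measurable_EFinP.
Qed.

Lemma measurable_ordered_region : measurable D.
Proof.
have -> : D = box (fun=> S) `&` \bigcap_(ij in [set: 'I_M * 'I_M])
    (if (ij.1 <= ij.2)%N then
      setT `&` [set x : M.-tuple T | tnth x ij.2 <= tnth x ij.1] else setT).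
  apply/seteqP; split=> x /=.
    by move=> [xS xle]; split=> // -[i j] _ /=; case: ifPn => // /xle.
  by move=> [xS xle]; split=> // i j ij; have := xle (i, j) I; rewrite /= ij => -[].
apply: measurableI; first by apply: measurable_box => i; exact: measurable_segment.
apply: fin_bigcap_measurable => // -[i j] _ /=; case: ifPn => // _.
by apply: measurable_fun_le => //; exact: measurable_tnth.
Qed.

Lemma exists_sorting n (x : n.-tuple R) :
  exists s : 'S_n, forall i j : 'I_n, (i <= j)%N ->
    tnth (permute s x) j <= tnth (permute s x) i.
Proof.
have sz : size (sort >=%R x) == n by rewrite size_sort size_tuple.
have /tuple_permP[s sE] : perm_eq (Tuple sz) x by rewrite /= perm_sort.
exists s => i j ij.
have -> : permute s x = Tuple sz by exact/val_inj/esym.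
rewrite !(tnth_nth 0).
apply: (@sorted_leq_nth _ >=%R ge_trans ge_refl) => //; rewrite ?inE ?size_tuple//.
by apply: sort_sorted; exact: ge_total.
Qed.

Lemma sorting_uniq n (x : n.-tuple R) (s t : 'S_n) : injective (tnth x) ->
  (forall i j : 'I_n, (i <= j)%N -> tnth (permute s x) j <= tnth (permute s x) i) ->
  (forall i j : 'I_n, (i <= j)%N -> tnth (permute t x) j <= tnth (permute t x) i) ->
  s = t.
Proof.
move=> injx sx tx.
have srt (y : n.-tuple R) :
    (forall i j : 'I_n, (i <= j)%N -> tnth y j <= tnth y i) -> sorted >=%R y.
  move=> yle; rewrite (sorted_pairwise ge_trans); apply/(pairwiseP 0) => i j.
  rewrite !inE size_tuple => i_n j_n ij.
  by have := yle (Ordinal i_n) (Ordinal j_n) (ltnW ij); rewrite !(tnth_nth 0).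
have E : permute s x = permute t x.
  apply/val_inj/(sorted_eq ge_trans ge_anti); [exact: srt|exact: srt|].
  rewrite (@perm_trans _ x)//; first by apply/tuple_permP; exists s.
  by rewrite perm_sym; apply/tuple_permP; exists t.
apply/permP => i; apply: injx.
by have := congr1 (fun y => tnth y i) E; rewrite !tnth_permute.
Qed.

(** Distinct coordinates are sorted by exactly one permutation: the reorderings of
    the ordered region tile the cube away from ties. *)
Lemma sum_indic_sorted (x : M.-tuple T) : injective (tnth x) -> box (fun=> S) x ->
  \sum_(s : 'S_M) (\1_D (permute s x))%:C = 1 :> R[i].
Proof.
move=> injx xS; have [s sx] := exists_sorting x.
have DE t : D (permute t x) <-> t = s.
  split=> [[_ tx]|->]; first exact: sorting_uniq tx sx.
  by split=> //; apply/box_permute.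
rewrite (bigD1 s)//= big1 ?addr0 => [|t ts].
  by rewrite indicE mem_set//; exact/DE.
by rewrite indicE memNset// => /DE; exact/eqP.
Qed.

End sorting.

(** * The tensor as an integral over the cube *)

Section tensor_integral.
Context (R : realType) (M N : nat) (leMN : (M <= N)%N).
Context (alpha beta : \bar R).
Notation T := (measurableTypeR R).
Variables (K : R[i]) (Phi : 'I_M -> R -> R[i]) (Psi : 'I_N -> R -> R[i]).
Variables (Psibar : 'I_N -> 'I_N -> R[i]) (xi : R -> R[i]).
Variable (phi : 'I_M -> R -> R[i]).
Notation S := (segment alpha beta : set T).
Notation D := (@ordered_region R M alpha beta).
Notation f := (jpdf K Phi Psi Psibar xi).
Notation leb := (lebesgue_tuple R M).

(** The entries of [tensorA] before integration, the [k]-th slice being taken at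
    the [k]-th coordinate. *)
Definition tensor_at (x : M.-tuple R) (i j k : 'I_N) : R[i] :=
  match (insub (val k) : option 'I_M) with
  | Some k' => tensor_integrand Phi Psi xi phi i j k' (tnth x k')
  | None => if (i < k)%N then 0 else Psibar j k
  end.

Definition prod_phi (x : M.-tuple R) : R[i] := \prod_(k < M) phi k (tnth x k).

(** Case by case, [tensor_at] is the product of an entry of the bordered matrix
    [Phi], of an entry of [Psi] and of a factor [c k]. *)
Lemma pseudo_det_tensor_at (x : M.-tuple R) :
  K * pseudo_det (tensor_at x) = f x * prod_phi x.
Proof.
pose c (k : 'I_N) : R[i] := if (insub (val k) : option 'I_M) is Some k'
  then xi (tnth x k') * phi k' (tnth x k') else 1.
have cE : \prod_(i < M) xi (tnth x i) * prod_phi x = \prod_(k < N) c k.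
  rewrite /prod_phi -big_split/= /c.
  rewrite (prod_insub leMN (fun _ k' => xi (tnth x k') * phi k' (tnth x k')) (fun=> 1)).
  by rewrite big1_eq mulr1.
rewrite /jpdf -!mulrA; congr (_ * _); rewrite cE mulrA.
rewrite -(det_extend leMN (Phi_mx Phi x)) -pseudo_det_rank1; congr pseudo_det.
apply/funext => i; apply/funext => j; apply/funext => k.
rewrite /tensor_at /c !mxE; case: insubP => [k' _ _|_]; last first.
  by case: ifP => _; rewrite ?mul0r ?mul1r ?mulr1.
rewrite /tensor_integrand; case: insubP => [i' _ _|_]; last by rewrite mul1r mulrA.
by rewrite mxE !mulrA.
Qed.

Hypothesis iA : forall (i j : 'I_N) (k : 'I_M),
  cintegrable (@lebesgue_measure R) S (tensor_integrand Phi Psi xi phi i j k).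

Lemma cintegral_prod_tensor_at (m a : 'I_N -> 'I_N) :
  let G := fun x : M.-tuple T =>
    (\1_(box (fun=> S)) x)%:C * \prod_(k < N) tensor_at x (m k) (a k) k in
  cintegrable leb setT G /\
  cintegral leb setT G =
    \prod_(k < N) tensorA alpha beta Phi Psi Psibar xi phi (m k) (a k) k.
Proof.
pose w (k : 'I_M) := widen_ord leMN k.
(* The factors of the last columns are constant. *)
pose V := \prod_(k < N | (M <= k)%N) (if (m k < k)%N then 0 else Psibar (a k) k).
pose h (k : 'I_M) (t : T) : R[i] :=
  (\1_S t)%:C * tensor_integrand Phi Psi xi phi (m (w k)) (a (w k)) k t.
have ih k : cintegrable (@lebesgue_measure R) setT (h k).
  by apply/(cintegrable_mkindic _ _ (measurable_segment alpha beta)); exact: iA.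
have [ip Ep] := cintegral_tuple_prod ih.
move=> G.
have -> : G = fun x => V * \prod_(k < M) h k (tnth x k).
  apply/funext => x; rewrite /G /tensor_at (prod_insub leMN
    (fun k k' => tensor_integrand Phi Psi xi phi (m k) (a k) k' (tnth x k'))
    (fun k => if (m k < k)%N then 0 else Psibar (a k) k)).
  rewrite mulrA mulrC; congr (_ * _); rewrite /h big_split/=; congr (_ * _).
  rewrite indicE; case: (boolP (x \in _)) => [/set_mem xS|/negP xS].
    by rewrite big1// => k _; rewrite indicE mem_set//; exact: xS.
  have [k kS] : exists k, ~ S (tnth x k).
    by apply/not_existsP => H; apply: xS; apply/mem_set => k; apply: contrapT; exact: H.
  by rewrite (bigD1 k)//= indicE memNset// mul0r.
split; first exact: cintegrableZ.
rewrite cintegralZ// Ep mulrC /tensorA (prod_insub leMN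
  (fun k k' => cintegral (@lebesgue_measure R) S
     (tensor_integrand Phi Psi xi phi (m k) (a k) k'))
  (fun k => if (m k < k)%N then 0 else Psibar (a k) k)).
congr (_ * _); apply: eq_bigr => k _.
by rewrite [RHS]cintegral_mkindic.
Qed.

(** The formula [f] for the density makes sense on the whole cube, where it is the
    symmetric extension of the density on the ordered region. *)
Definition extended_integrand (x : M.-tuple T) : R[i] :=
  (\1_(box (fun=> S)) x)%:C * (f x * prod_phi x).

Lemma cintegral_extended_integrand :
  cintegrable leb setT extended_integrand /\
  cintegral leb setT extended_integrand =
    K * pseudo_det (tensorA alpha beta Phi Psi Psibar xi phi).
Proof.
pose G (m a : 'S_N) (x : M.-tuple T) :=
  (\1_(box (fun=> S)) x)%:C * \prod_(k < N) tensor_at x (m k) (a k) k.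
have iG m a : cintegrable leb setT (G m a) by case: (cintegral_prod_tensor_at m a).
have EG m a : cintegral leb setT (G m a) =
    \prod_(k < N) tensorA alpha beta Phi Psi Psibar xi phi (m k) (a k) k.
  by case: (cintegral_prod_tensor_at m a).
pose H (m : 'S_N) x := (-1) ^+ m * \sum_(a : 'S_N) (-1) ^+ a * G m a x.
have iGa (m a : 'S_N) : cintegrable leb setT (fun x => (-1) ^+ a * G m a x).
  exact: cintegrableZ.
have iS (m : 'S_N) : cintegrable leb setT (fun x => \sum_(a : 'S_N) (-1) ^+ a * G m a x).
  exact: cintegrable_sum.
have iH (m : 'S_N) : cintegrable leb setT (H m) by exact: cintegrableZ.
have wE : extended_integrand = fun x => K * \sum_(m : 'S_N) H m x.
  apply/funext => x; rewrite /extended_integrand -pseudo_det_tensor_at mulrCA; congr (_ * _).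
  rewrite /pseudo_det mulr_sumr; apply: eq_bigr => m _.
  rewrite mulrCA; congr (_ * _); rewrite mulr_sumr; apply: eq_bigr => a _.
  by rewrite mulrCA.
have iHs : cintegrable leb setT (fun x => \sum_(m : 'S_N) H m x).
  exact: cintegrable_sum.
rewrite wE; split; first exact: cintegrableZ.
rewrite cintegralZ// cintegral_sum//; congr (_ * _); apply: eq_bigr => m _.
rewrite cintegralZ// cintegral_sum//; congr (_ * _); apply: eq_bigr => a _.
by rewrite cintegralZ// EG.
Qed.

Lemma extended_integrand_permute (s : 'S_M) (x : M.-tuple T) :
  extended_integrand (permute s x) =
  (\1_(box (fun=> S)) x)%:C * (f x * prod_phi (permute s x)).
Proof.
rewrite /extended_integrand jpdf_permute//; congr (_%:C * _).
by rewrite !indicE; congr (_%:R); congr (nat_of_bool _);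
  apply/idP/idP => /set_mem xS; apply/mem_set/box_permute/xS.
Qed.

(** Changing variables by [s] moves the permutation from the integrand to the
    indicator, and the indicators of the reorderings of [D] add up to one
    wherever the integrand does not vanish. *)
Lemma cintegral_sorted_pieces :
  (forall s : 'S_M,
    cintegrable leb setT (fun x => (\1_D x)%:C * extended_integrand (permute s x))) /\
  \sum_(s : 'S_M) cintegral leb setT (fun x => (\1_D x)%:C * extended_integrand (permute s x)) =
  cintegral leb setT extended_integrand.
Proof.
have [iw _] := cintegral_extended_integrand.
pose Q (s : 'S_M) (x : M.-tuple T) := (\1_D (permute s x))%:C * extended_integrand x.
have iQ s : cintegrable leb setT (Q s).
  have -> : Q s = fun x => (\1_(permute s @^-1` D) x)%:C * extended_integrand x by [].
  apply: cintegrable_indicM => //.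
  rewrite -[X in measurable X]setTI; apply: measurable_permute => //.
  exact: measurable_ordered_region.
have QE s : (fun x => (\1_D x)%:C * extended_integrand (permute s x)) = Q (s^-1)%g \o permute s.
  by apply/funext => x; rewrite /Q /= permuteM mulVg permute1.
split=> [s|]; first by rewrite QE; exact: (cintegral_permute s (iQ _)).1.
under eq_bigr => s _ do rewrite QE (cintegral_permute s (iQ _)).2.
rewrite (reindex_inj invg_inj) /=; under eq_bigr do rewrite invgK.
rewrite -cintegral_sum//; apply: eq_cintegral => x _.
rewrite -mulr_suml; have [->|w0] := eqVneq (extended_integrand x) 0; first by rewrite mulr0.
rewrite sum_indic_sorted ?mul1r//.
  move=> i j xij; apply: contrapT => /eqP ij; move/eqP: w0; apply.
  by rewrite /extended_integrand (jpdf_tie _ _ _ _ _ ij xij) mul0r mulr0.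
apply: contrapT => xS; move/eqP: w0; apply.
by rewrite /extended_integrand indicE memNset// mul0r.
Qed.

End tensor_integral.

(** * Conditioning on the permutation *)

Section unordered_expectation.
Context (R : realType) (d : measure_display) (Omega : measurableType d).
Context (P : probability Omega R) (M N : nat) (leMN : (M <= N)%N).
Context (alpha beta : \bar R).
Variables (K : R[i]) (Phi : 'I_M -> R -> R[i]) (Psi : 'I_N -> R -> R[i]).
Variables (Psibar : 'I_N -> 'I_N -> R[i]) (xi : R -> R[i]).
Variable (phi : 'I_M -> R -> R[i]).
Variables (lambda : 'I_M -> {RV P >-> R}) (sigma : Omega -> 'S_M).
Notation T := (measurableTypeR R).
Notation D := (@ordered_region R M alpha beta).
Notation f := (jpdf K Phi Psi Psibar xi).
Notation leb := (lebesgue_tuple R M).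

Lemma measurable_rvec : measurable_fun setT (rvec lambda).
Proof.
apply/measurable_fun_tnthP => i.
have -> : (@tnth M T)^~ i \o rvec lambda = lambda i.
  by apply/funext => w /=; rewrite tnth_mktuple.
exact: (@measurable_funPT _ _ _ _ (lambda i)).
Qed.

Lemma tnth_rvec w i : tnth (rvec lambda w) i = lambda i w.
Proof. by rewrite tnth_mktuple. Qed.

Hypotheses (hpdf : has_pdf lambda D f).
Hypotheses (hunif : uniform_perm P sigma) (hindep : indep_perm lambda sigma).

Lemma pdf_real x : D x -> complex.Im (f x) = 0 /\ 0 <= complex.Re (f x).
Proof.
case: hpdf => -[f0 _ _] _ Dx; have := f0 _ Dx.
by rewrite lecE /= => /andP[/eqP -> ->].
Qed.

(** [q] is the density of the ordered vector with respect to the measure on all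
    tuples, and [p] the density of its law restricted to an event [sigma = s]. *)
Let q (x : M.-tuple T) : R := \1_D x * complex.Re (f x).
Let p (x : M.-tuple T) : R := (M`!)%:R^-1 * q x.

Lemma measurable_q : measurable_fun setT q.
Proof.
case: hpdf => -[_ mf _] _.
have mD := @measurable_ordered_region R M alpha beta.
rewrite (_ : q = (fun x => complex.Re (f x)) \_ D).
  exact: (measurable_restrictT _ mD).1 mf.
by apply/funext => x; rewrite patchE /q indicE; case: ifP; rewrite ?mul1r ?mul0r.
Qed.

Lemma q_ge0 x : 0 <= q x.
Proof.
rewrite /q indicE; case: (boolP (x \in D)) => [/set_mem /pdf_real[_]|_].
  by rewrite mul1r.
by rewrite mul0r.
Qed.

Lemma rvec_sigma_density (s : 'S_M) B : measurable B ->
  (P (rvec lambda @^-1` B `&` sigma @^-1` [set s]) = \int[leb]_(x in B) (p x)%:E)%E.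
Proof.
move=> mB; case: hpdf => _ hB; have mq := measurable_q.
rewrite hindep// (hunif s).2 hB// muleC.
rewrite [in RHS]integral_mkindic integral_mkindic.
rewrite -ge0_integralZl_EFin//.
- by apply: eq_integral => x _; rewrite -EFinM /p /q indicI /=; congr EFin; ring.
- by move=> x _; rewrite lee_fin indicI /= -mulrA mulr_ge0// q_ge0.
- have -> : (fun x => (\1_(B `&` D) x * complex.Re (f x))%:E) =
      (fun x => (\1_B x * q x)%:E).
    by apply/funext => x; rewrite indicI /= -mulrA.
  by apply/measurable_EFinP/measurable_funM.
Qed.

(** The density is real on [D], so it multiplies the real and the imaginary part
    of the product of the [phi k] separately. *)
Lemma cintegral_prod_phi_permute (s : 'S_M) :
  let H := fun x => (\1_D x)%:C * (f x * prod_phi phi (permute s x)) in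
  cintegrable leb setT H ->
  cintegrable P (sigma @^-1` [set s])
    (fun w => prod_phi phi (permute s (rvec lambda w))) ->
  cintegral P (sigma @^-1` [set s])
    (fun w => prod_phi phi (permute s (rvec lambda w))) =
  (M`!)%:R^-1 * cintegral leb setT H.
Proof.
move=> H iH iX; set g := fun x => prod_phi phi (permute s x).
have E1 x : complex.Re (((M`!)%:R^-1 : R)%:C * H x) = complex.Re (g x) * p x.
  rewrite complexReMr /H complexReMr /p /q indicE.
  case: (boolP (x \in D)) => [/set_mem /pdf_real[f0 _]|_]; last by rewrite !mul0r !mulr0.
  by rewrite complexReM f0 /g; ring.
have E2 x : complex.Im (((M`!)%:R^-1 : R)%:C * H x) = complex.Im (g x) * p x.
  rewrite complexImMr /H complexImMr /p /q indicE.
  case: (boolP (x \in D)) => [/set_mem /pdf_real[f0 _]|_]; last by rewrite !mul0r !mulr0.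
  by rewrite complexImM f0 /g; ring.
have -> : (M`!)%:R^-1 = ((M`!)%:R^-1 : R)%:C :> R[i] by rewrite fmorphV rmorph_nat.
rewrite -cintegralZ//.
have [j1 j2] := cintegrableZ ((M`!)%:R^-1 : R)%:C iH.
have i1 : leb.-integrable setT (fun x => (complex.Re (g x) * p x)%:E).
  by apply: eq_integrable j1 => // x _; rewrite E1.
have i2 : leb.-integrable setT (fun x => (complex.Im (g x) * p x)%:E).
  by apply: eq_integrable j2 => // x _; rewrite E2.
have mp : measurable_fun setT p by apply: measurable_funM => //; exact: measurable_q.
have p0 x : 0 <= p x by rewrite mulr_ge0// q_ge0.
have mE := (hunif s).1.
have dens h := @integral_density _ _ _ _ R P leb (rvec lambda) _ p measurable_rvec mE
  mp p0 (@rvec_sigma_density s) h.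
congr (fine _ +i* fine _).
  rewrite (dens (fun x => complex.Re (g x)) iX.1 i1).
  by apply: eq_integral => x _; rewrite E1.
rewrite (dens (fun x => complex.Im (g x)) iX.2 i2).
by apply: eq_integral => x _; rewrite E2.
Qed.

End unordered_expectation.

Theorem theorem4p4 (R : realType) (d : measure_display)
    (Omega : measurableType d) (P : probability Omega R)
    (M N : nat) (hM : (1 <= M)%N) (hMN : (M <= N)%N)
    (alpha beta : \bar R) (hab : (alpha < beta)%E)
    (K : R[i]) (Phi : 'I_M -> R -> R[i]) (Psi : 'I_N -> R -> R[i])
    (Psibar : 'I_N -> 'I_N -> R[i]) (xi : R -> R[i])
    (phi : 'I_M -> R -> R[i])
    (lambda : 'I_M -> {RV P >-> R})
    (hlambda : forall w, ordered_region alpha beta (rvec lambda w))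
    (hpdf : has_pdf lambda (ordered_region alpha beta)
              (jpdf K Phi Psi Psibar xi))
    (sigma : Omega -> 'S_M)
    (hunif : uniform_perm P sigma) (hindep : indep_perm lambda sigma)
    (hA : forall (i j : 'I_N) (k : 'I_M),
        cintegrable (@lebesgue_measure R) (segment alpha beta)
          (tensor_integrand Phi Psi xi phi i j k))
    (hE : cintegrable P setT
            (fun w => \prod_(l < M) phi l (unordered lambda sigma l w))) :
  cexpectation P (fun w => \prod_(l < M) phi l (unordered lambda sigma l w)) =
  K / (M`!)%:R * pseudo_det (tensorA alpha beta Phi Psi Psibar xi phi).
Proof.
set X := fun w => \prod_(l < M) phi l (unordered lambda sigma l w).
pose E (s : 'S_M) := sigma @^-1` [set s].
have mE s : measurable (E s) by case: (hunif s).
pose g (s : 'S_M) w := prod_phi phi (permute s (rvec lambda w)).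
have XE s : {in E s, X =1 g s}.
  move=> w /set_mem ws; apply: eq_bigr => l _.
  by rewrite tnth_permute tnth_rvec /unordered ws.
have iX s : cintegrable P (E s) X.
  by case: hE => Xr Xi; split; apply: (integrableS measurableT).
have ig s : cintegrable P (E s) (g s) by exact: eq_cintegrable (XE s) (iX s).
have iX1 s : cintegrable P setT (fun w => (\1_(E s) w)%:C * X w).
  exact/(cintegrable_mkindic _ _ (mE s)).
transitivity (cintegral P setT X).
  by rewrite /cexpectation unlock.
have [iw Ew] := cintegral_extended_integrand hMN (alpha := alpha) (beta := beta) K Psibar hA.
have [iD ED] := cintegral_sorted_pieces hMN (alpha := alpha) (beta := beta) K Psibar hA.
transitivity (\sum_(s : 'S_M) (M`!)%:R^-1 * cintegral (lebesgue_tuple R M) setT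
    (fun x => (\1_(@ordered_region R M alpha beta) x)%:C *
       extended_integrand alpha beta K Phi Psi Psibar xi phi (permute s x))); last first.
  rewrite -mulr_sumr ED Ew; ring.
transitivity (\sum_(s : 'S_M) cintegral P (E s) (g s)).
  under eq_bigr => s _ do rewrite -(eq_cintegral P (XE s)) cintegral_mkindic.
  rewrite -cintegral_sum//; apply: eq_cintegral => w _.
  rewrite -mulr_suml (bigD1 (sigma w))//= big1 ?addr0 => [|s sw].
    by rewrite indicE mem_set// mul1r.
  by rewrite indicE memNset// => /esym/eqP; apply/negP.
apply: eq_bigr => s _.
have HE : (fun x => (\1_(@ordered_region R M alpha beta) x)%:C *
       extended_integrand alpha beta K Phi Psi Psibar xi phi (permute s x)) =
   fun x => (\1_(@ordered_region R M alpha beta) x)%:C *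
       (jpdf K Phi Psi Psibar xi x * prod_phi phi (permute s x)).
  apply/funext => x; rewrite extended_integrand_permute// indicE.
  case: (boolP (x \in _)) => [/set_mem[xS _]|_]; last by rewrite !mul0r.
  by rewrite indicE mem_set//= !mul1r.
have := iD s; rewrite HE => iH.
exact: (cintegral_prod_phi_permute hpdf hunif hindep iH (ig s)).
Qed.
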